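(* Let $n$ be a positive integer and let $Q$ be an $(n,n+1)$-Dyck path. Then $\zeta^{-1}(Q)=\iota(Q,Q^r)$, where $Q^r$ is the reverse path of $Q$.
   Context: Set $a=n$, $b=n+1$. An $(a,b)$-Dyck path is a lattice path from $(0,0)$ to $(b,a)$ with unit north steps and unit east steps, all of whose lattice points $(x,y)$ satisfy $ax\le by$; it is drawn in the grid with $a$ rows and $b$ columns. $\mathfrak{D}_{a,b}$ is the set of all of them. The partition bounded by a path is the partition whose Young diagram (English notation) is the set of boxes of the grid above (northwest of) the path. The reverse path $Q^r$ of an $(n,n+1)$-Dyck path $Q$ bounding the partition $\lambda$ is the $(n,n+1)$-Dyck path bounding the conjugate partition $\lambda^c$. Hooks and cores: the unit box with southeast corner $(x,y)$ has hook filling $by-ax$. The positive hooks of $P$ are the positive hook fillings of the boxes of the grid lying below (southeast of) $P$. $\mathfrak{c}(P)$ is the partition whose set of first-column hook lengths is the set of positive hooks of $P$ (it has no hook length equal to $a$ or $b$). For a partition $\kappa$ and a positive integer $m$: consider the hook lengths of the boxes in the first column of $\kappa$; for each residue modulo $m$ that occurs take the largest such hook length; the rows of $\kappa$ with these first-column hook lengths are the $m$-rows. The $m$-boundary of $\kappa$ is the set of boxes with hook length less than $m$. Zeta: $\lambda(P)=(\lambda_1\ge\dots\ge\lambda_a)$ has as parts the numbers of $b$-boundary boxes in the $a$-rows of $\mathfrak{c}(P)$ (padded with zeros). $\zeta(P)$ is the $(a,b)$-Dyck path bounding $\lambda(P)$. In the case $(a,b)=(n,n+1)$ the map $\zeta:\mathfrak{D}_{n,n+1}\to\mathfrak{D}_{n,n+1}$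 is known to be a bijection, and $\zeta^{-1}$ denotes its inverse. The map $\iota$, applied to a pair $(Q,R)$ of $(a,b)$-Dyck paths: (1) Draw $Q$ in the grid, and rotate $R$ by $180^\circ$ so that it becomes a path from $(0,0)$ to $(b,a)$ below the diagonal. Label the steps of each of these two paths by $1,\dots,a+b$ in order from the bottom-left corner to the top-right corner. (2) Define $\gamma:\{1,\dots,a+b\}\to\{1,\dots,a+b\}$: if $l$ labels a horizontal step of $Q$, $\gamma(l)$ is the label of the horizontal step of rotated $R$ in the same column; if $l$ labels a vertical step of $Q$, $\gamma(l)$ is the label of the vertical step of rotated $R$ in the same row. (3) For the pairs considered here, $\gamma$ is a single $(a+b)$-cycle; write it in cycle notation as $(\sigma_1,\sigma_2,\dots,\sigma_{a+b})$ with $\sigma_1=1$ (so $\sigma_{i+1}=\gamma(\sigma_i)$). Then $\iota(Q,R)$ is the path whose $i$-th step is east if $i$ is a cyclic descent of the sequence $\sigma$ (i.e. $\sigma_i>\sigma_{i+1}$, indices modulo $a+b$) and north otherwise. *)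

(* Defs.v *)
From mathcomp Require Import all_boot.
From mathcomp Require Import zify.

Set Implicit Arguments.
Unset Strict Implicit.
Unset Printing Implicit Defensive.

(* A lattice path from the origin is the word of its steps.                   *)
Definition lpath := seq bool.
Definition north : bool := true.
Definition east : bool := false.

(* Coordinates of the lattice point reached after k steps.                    *)
Definition xcoord (P : lpath) (k : nat) : nat := count_mem east (take k P).
Definition ycoord (P : lpath) (k : nat) : nat := count_mem north (take k P).

Definition dyck (a b : nat) (P : lpath) : bool :=
  [&& count_mem north P == a, count_mem east P == b &
      all (fun k => a * xcoord P k <= b * ycoord P k) (iota 0 (size P).+1)].

(* Position in P of its k-th step equal to s (positions and k start at 0).    *)
Definition step_pos (s : bool) (P : lpath) (k : nat) : nat :=
  nth 0 [seq i <- iota 0 (size P) | nth north P i == s] k.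

(* Abscissa of the north step from height y to height y + 1, i.e. the number  *)
(* of boxes to the left of P in that row.                                     *)
Definition row_width (P : lpath) (y : nat) : nat :=
  xcoord P (step_pos north P y).

(* Partitions are weakly decreasing sequences, possibly padded with zeros;    *)
(* part i (from 0) is the i-th row from the top in English notation, whereas  *)
(* heights y in the grid are counted from the bottom.                         *)
Definition path_partition (a : nat) (P : lpath) : seq nat :=
  mkseq (fun i => row_width P (a - i.+1)) a.

(* The path from (0, 0) to (b, a) with mu as its boxes to the northwest; see  *)
(* bounding_path_partition below.                                             *)
Definition bounding_path (a b : nat) (mu : seq nat) : lpath :=
  flatten [seq rcons (nseq (nth 0 mu i - nth 0 mu i.+1) east) north
          | i <- rev (iota 0 a)]
  ++ nseq (b - nth 0 mu 0) east.

Lemma step_pos_cons (s x : bool) (P : lpath) (k : nat) :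
  k < count_mem s (x :: P) ->
  step_pos s (x :: P) k =
    if x == s then (if k is k'.+1 then (step_pos s P k').+1 else 0)
    else (step_pos s P k).+1.
Proof.
have sz : size [seq i <- iota 0 (size P) | nth north P i == s] = count_mem s P.
  rewrite size_filter -[in RHS](mkseq_nth north P) count_map.
  by apply: eq_count => i /=.
have E : [seq i <- iota 1 (size P) | nth north (x :: P) i == s]
       = [seq i.+1 | i <- [seq i <- iota 0 (size P) | nth north P i == s]].
  by rewrite (iotaDl 1 0) filter_map.
rewrite /step_pos /= E; case: eqP => _ /=.
  case: k => [|k] //=; rewrite ltnS => kh; rewrite (nth_map 0) // sz; exact: kh.
by move=> kh; rewrite (nth_map 0) // sz; exact: kh.
Qed.

Lemma row_width_cat (d : nat) (P : lpath) (k : nat) :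
  k < (count_mem north P).+1 ->
  row_width (rcons (nseq d east) north ++ P) k =
    d + (if k is k'.+1 then row_width P k' else 0).
Proof.
move=> kh; rewrite /row_width /xcoord; elim: d => [|d IH] /=.
  rewrite step_pos_cons //= .
  by case: k kh => [|k].
rewrite step_pos_cons /= ?IH //= count_cat -cats1 count_cat /=.
by move: (count_mem _ P) kh (count_mem _ (nseq d _)) => c kh c'; lia.
Qed.

Lemma bounding_path_partition (a b : nat) (mu : seq nat) :
  size mu = a -> sorted geq mu -> path_partition a (bounding_path a b mu) = mu.
Proof.
move=> <- mu_s; apply: (@eq_from_nth _ 0); rewrite size_mkseq // => i ih.
rewrite nth_mkseq // /bounding_path; set T := nseq _ east.
set F := fun i => rcons (nseq (nth 0 mu i - nth 0 mu i.+1) east) north.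
have mono j : nth 0 mu j.+1 <= nth 0 mu j.
  have [jh|jh] := ltnP j.+1 (size mu); last by rewrite nth_default.
  by move/(sortedP 0): mu_s; apply.
have rowsS m : flatten [seq F i | i <- rev (iota 0 m.+1)] ++ T
             = F m ++ (flatten [seq F i | i <- rev (iota 0 m)] ++ T).
  by rewrite -addn1 iotaD rev_cat /= add0n catA.
have cnt m : m <= count_mem north (flatten [seq F i | i <- rev (iota 0 m)] ++ T).
  elim: m => // m IH; rewrite rowsS count_cat /F -cats1 count_cat /=.
  by move: (count_mem _ (_ ++ _)) IH (count_mem _ (nseq _ _)) => c h c'; lia.
have W m k : k < m ->
    row_width (flatten [seq F i | i <- rev (iota 0 m)] ++ T) k
    = nth 0 mu (m - k.+1) - nth 0 mu m.
  elim: m k => // m IH k km.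
  rewrite rowsS row_width_cat; last by rewrite ltnS in km *; exact: leq_trans km (cnt m).
  case: k km => [|k] km; first by rewrite addn0 subn1.
  rewrite IH // subSS.
  have le : nth 0 mu m <= nth 0 mu (m - k.+1).
    elim: (k.+1) => [|q]; first by rewrite subn0.
    move=> h; apply: (leq_trans h); have [qm|qm] := ltnP q m.
      by have := mono (m - q.+1); rewrite -subSn // subSS.
    by have -> : m - q.+1 = m - q by lia.
  by have := mono m; lia.
rewrite W; last by lia.
by rewrite [X in _ - X]nth_default // subn0; congr (nth 0 mu _); lia.
Qed.

Definition column_height (mu : seq nat) (j : nat) : nat :=
  count (fun p => j < p) mu.

Definition conjugate (mu : seq nat) : seq nat :=
  mkseq (column_height mu) (nth 0 mu 0).

Definition reverse_path (n : nat) (Q : lpath) : lpath :=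
  bounding_path n n.+1 (conjugate (path_partition n Q)).

(* Hook length (arm + leg + 1) of the box in row i and column j of mu.        *)
Definition hook_length (mu : seq nat) (i j : nat) : nat :=
  ((nth 0 mu i - j.+1) + (column_height mu j - i.+1)).+1.

Definition first_column_hooks (mu : seq nat) : seq nat :=
  [seq hook_length mu i 0 | i <- iota 0 (column_height mu 0)].

(* (x, y) is the southeast corner of the box, so the box lies to the right of *)
(* P exactly when row_width P y < x.                                          *)
Definition positive_hooks (a b : nat) (P : lpath) : seq nat :=
  [seq b * c.2 - a * c.1
  | c <- [seq (x, y) | x <- iota 1 b, y <- iota 0 a]
  & (row_width P c.2 < c.1) && (a * c.1 < b * c.2)].

(* The partition whose first-column hook lengths are the elements of H; see   *)
(* first_column_hooks_partition below.                                        *)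
Definition partition_of_hooks (H : seq nat) : seq nat :=
  let h := sort geq (undup H) in
  mkseq (fun i => nth 0 h i - (size h - i.+1)) (size h).

Lemma nth_hooks_lb (h : seq nat) (i : nat) :
  sorted gtn h -> 0 \notin h -> i < size h -> size h - i <= nth 0 h i.
Proof.
elim: h i => [|x h IH] [|i] //= hs; rewrite inE negb_or => /andP[x0 h0] ih.
- case: h hs h0 {ih} IH => [|y h] /=; first by lia.
  by move=> /andP[xy ys] h0 /(_ 0 ys h0 isT) /=; lia.
- by rewrite subSS; apply: IH => //; apply: path_sorted hs.
Qed.

Lemma first_column_hooks_partition (H : seq nat) :
  0 \notin H ->
  first_column_hooks (partition_of_hooks H) = sort geq (undup H).
Proof.
move=> H0; rewrite /partition_of_hooks; set h := sort geq (undup H).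
have h0 : 0 \notin h by rewrite mem_sort mem_undup.
have hs : sorted gtn h.
  rewrite (gtn_sorted_uniq_geq h) sort_uniq undup_uniq /=.
  by apply: sort_sorted => x y; rewrite leq_total.
have lb := nth_hooks_lb hs h0.
rewrite /first_column_hooks; set mu := mkseq _ _.
have sz : column_height mu 0 = size h.
  rewrite /column_height -[RHS](size_mkseq (fun i => nth 0 h i - (size h - i.+1))) -/mu.
  apply/eqP; rewrite -all_count; apply/allP => p /mapP[i].
  by rewrite mem_iota => /andP[_ ih] ->; have := lb i ih; lia.
apply: (@eq_from_nth _ 0); rewrite size_map size_iota sz // => i ih.
rewrite (nth_map 0) ?size_iota // nth_iota // add0n /hook_length sz nth_mkseq //.
by have := lb i ih; lia.
Qed.

Definition core (a b : nat) (P : lpath) : seq nat :=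
  partition_of_hooks (positive_hooks a b P).

Definition mrows (m : nat) (mu : seq nat) : seq nat :=
  [seq i <- iota 0 (column_height mu 0)
  | all (fun h => (h == hook_length mu i 0 %[mod m]) ==>
                  (h <= hook_length mu i 0))
        (first_column_hooks mu)].

Definition boundary_boxes (m : nat) (mu : seq nat) (i : nat) : nat :=
  count (fun j => hook_length mu i j < m) (iota 0 (nth 0 mu i)).

Definition zeta_partition (a b : nat) (P : lpath) : seq nat :=
  let s := sort geq [seq boundary_boxes b (core a b P) i
                    | i <- mrows a (core a b P)] in
  s ++ nseq (a - size s) 0.

Definition zeta (a b : nat) (P : lpath) : lpath :=
  bounding_path a b (zeta_partition a b P).

(* Labels are shifted to start at 0.  The k-th east (north) step of a path    *)
(* lies in column (row) k, and rotating R by 180 degrees reverses its word.   *)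
Definition gamma (Q R : lpath) (l : nat) : nat :=
  let s := nth north Q l in
  step_pos s (rev R) (count_mem s (take l Q)).

Definition sigma (a b : nat) (Q R : lpath) : seq nat :=
  traject (gamma Q R) 0 (a + b).

Definition gamma_single_cycle (a b : nat) (Q R : lpath) : bool :=
  fcycle (gamma Q R) (sigma a b Q R) &&
  perm_eq (sigma a b Q R) (iota 0 (a + b)).

(* The map iota (a name already taken by the library); it is meaningful when  *)
(* gamma_single_cycle a b Q R holds.                                          *)
Definition iota_path (a b : nat) (Q R : lpath) : lpath :=
  let s := sigma a b Q R in
  mkseq (fun i => if nth 0 s (i.+1 %% (a + b)) < nth 0 s i
                  then east else north) (a + b).

(* Main.v *)
Require Import Defs.
From mathcomp Require Import all_boot.
From mathcomp Require Import zify.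

Set Implicit Arguments.
Unset Strict Implicit.
Unset Printing Implicit Defensive.

(** Give the lattice point (x, y) of a path P the level (n + 1) y - n x.  A
    north step raises the level by n + 1 and an east step lowers it by n.  Along
    an (n, n + 1)-Dyck path all levels are nonnegative, and since n and n + 1
    are coprime the 2n + 1 starting points of the steps have distinct levels.
    List these levels increasingly, V_0 = 0 < V_1 < ... < V_(2n).

    First, zeta P is the sweep of P, the word whose i-th letter is the type of
    the step that starts at level V_i ([zeta_sweep]).  Indeed an n-row of the
    core of P is given by a north step starting at a level v > n, its
    first-column hook being v - n, and the number of its (n + 1)-boundary boxes
    is the number of east steps starting below level v ([gaps_window],
    [easts_below_hook]).

    Secondly, let H be the set of positive hooks, and call a level v outgoing
    when v < n or v - n is in H, incoming when v < n + 1 or v - (n + 1) is in H.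
    At a level of P these say that the step which leaves is north, respectively
    that the step which arrives is east.  Clearly v + 1 is incoming exactly when
    v is outgoing, and at a number that is not a level of P the two notions
    agree.  Going up from V_i to V_(i+1) through numbers that are not levels we
    obtain that the step arriving at V_(i+1) is east exactly when the step
    leaving V_i is north ([in_east_next]).  So the word of the arriving steps,
    in the order of the levels, is an east step followed by the complement of
    zeta P without its last step, and this is the path zeta(P)^r rotated by 180
    degrees ([rev_reverse_sweep]).

    For Q = zeta P the permutation gamma therefore joins, for each type of step,
    the places of the departures to the places of the arrivals in increasing
    order.  All steps of one type change the level by the same amount, so gamma
    sends the rank of a point of P to the rank of the next point of P
    ([gamma_rank]): gamma is a single cycle, sigma lists the ranks along P, and
    its cyclic descents are the east steps of P.  Hence iota (Q, Q^r) = P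
    ([iota_sweep]), and zeta is injective on Dyck paths.

    Finally the sweep of a Dyck path is a Dyck path ([dyck_sweep]), so zeta is
    an injective map from the finite set of Dyck paths to itself, hence onto,
    and every Q is of the form zeta P. *)

(** * Counting in increasing sequences *)

Lemma count_none (T : eqType) (p : pred T) (s : seq T) :
  {in s, forall x, ~~ p x} -> count p s = 0.
Proof. by move/hasPn; rewrite has_count -leqNgt leqn0 => /eqP. Qed.

Lemma ltn_count (T : eqType) (p q : pred T) (s : seq T) (x : T) :
  {in s, subpred p q} -> x \in s -> q x -> ~~ p x -> count p s < count q s.
Proof.
move=> pq xs qx px; have pqs : count p s = count (predI p q) s.
  by apply: eq_in_count => y /pq /=; case: (p y) => // ->.
rewrite -[count q s]size_filter -(count_predC p) count_filter -pqs.
rewrite -[X in X < _]addn0 ltn_add2l -has_count; apply/hasP; exists x => //.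
by rewrite mem_filter qx.
Qed.

Lemma count_ltn_nth (s : seq nat) (i : nat) :
  sorted gtn s -> i < size s ->
  count (fun h => h < nth 0 s i) s = size s - i.+1.
Proof.
elim: s i => // x s IH i xs.
have xmax : all (gtn x) s.
  by apply: order_path_min xs => y u v /= h1 h2; apply: ltn_trans h2 h1.
case: i => [|i] /= ih.
  rewrite ltnn add0n subSS subn0 -[RHS](count_predT s).
  by apply/eq_in_count => y /(allP xmax).
rewrite IH // ?(path_sorted xs) // ltnNge ltnW ?add0n //.
by apply: (allP xmax); apply: mem_nth.
Qed.

Lemma take_nth_sorted (s : seq nat) (k : nat) : sorted ltn s -> k < size s ->
  take k s = [seq v <- s | v < nth 0 s k].
Proof.
elim: s k => // x s IH k xs.
have xmin : all (ltn x) s by apply: order_path_min xs; apply: ltn_trans.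
case: k => [|k] /= ks.
  rewrite ltnn; apply/esym/eqP; rewrite -size_eq0 size_filter count_none //.
  by move=> u /(allP xmin) /= xu; rewrite -leqNgt ltnW.
have xk : x < nth 0 s k by apply: (allP xmin); apply: mem_nth.
by rewrite xk IH ?(path_sorted xs).
Qed.

Lemma take_index_sorted (s : seq nat) (v : nat) : sorted ltn s -> v \in s ->
  take (index v s) s = [seq u <- s | u < v].
Proof. by move=> ss vs; rewrite take_nth_sorted ?index_mem // nth_index. Qed.

Lemma index_ltn_sorted (s : seq nat) (u v : nat) : sorted ltn s ->
  u \in s -> v \in s -> (index u s < index v s) = (u < v).
Proof.
move=> ss us vs; have mono := sorted_ltn_index ltn_trans ss.
apply/idP/idP => [|uv]; first exact: mono.
rewrite ltnNge leq_eqVlt; apply/negP.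
move=> /predU1P[E|/(mono _ _ vs us)]; last by lia.
by move: uv; rewrite -(nth_index 0 us) -(nth_index 0 vs) E ltnn.
Qed.

(** * Positions of steps and row widths of a path *)

Lemma count_east_north (W : lpath) :
  count_mem east W + count_mem north W = size W.
Proof.
by rewrite -(count_predC (pred1 east)); congr addn; apply: eq_count; case.
Qed.

Lemma coordS (P : lpath) (k : nat) : k < size P ->
  xcoord P k.+1 = xcoord P k + ~~ nth north P k /\
  ycoord P k.+1 = ycoord P k + nth north P k.
Proof.
move=> kP; rewrite /xcoord /ycoord (take_nth north kP) -cats1 !count_cat /=.
by case: (nth north P k); rewrite ?addn0.
Qed.

Lemma coord_sum (P : lpath) (k : nat) :
  k <= size P -> xcoord P k + ycoord P k = k.
Proof. by move=> kP; rewrite /xcoord /ycoord count_east_north size_takel. Qed.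

Lemma leq_coord (P : lpath) (j k : nat) :
  j <= k -> xcoord P j <= xcoord P k /\ ycoord P j <= ycoord P k.
Proof.
move=> jk; rewrite /xcoord /ycoord -(take_takel P jk).
split; rewrite -[X in _ <= count_mem _ X](cat_take_drop j) count_cat;
  exact: leq_addr.
Qed.

Lemma step_posP (s : bool) (P : lpath) (k : nat) :
  k < count_mem s P ->
  [/\ step_pos s P k < size P, nth north P (step_pos s P k) = s
    & count_mem s (take (step_pos s P k) P) = k].
Proof.
elim: P k => // x P IH k kP; rewrite step_pos_cons //.
move: kP; rewrite /=; case: eqP => [->|xs] /=.
  case: k => [|k] //=; rewrite add1n ltnS => /IH[h1 h2 ->].
  by rewrite eqxx add1n.
by rewrite add0n => /IH[h1 h2 ->]; rewrite (introF eqP xs).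
Qed.

Lemma step_pos_count (s : bool) (W : lpath) (j : nat) :
  j < size W -> nth north W j = s -> step_pos s W (count_mem s (take j W)) = j.
Proof.
have pos W' i : i < size W' -> nth north W' i = s ->
    count_mem s (take i W') < count_mem s W'.
  move=> iW <-; rewrite -[X in _ < count_mem _ X](cat_take_drop i) count_cat.
  by rewrite (drop_nth north iW) /= eqxx; lia.
elim: W j => // x W IH [|j] jW jE.
  by move: jE => /= <-; rewrite step_pos_cons /= eqxx.
rewrite step_pos_cons; last exact: pos.
by move: jW jE => /= jW jE; case: eqP => _ /=; rewrite ?add1n ?add0n IH.
Qed.

(** The abscissas of the north steps from bottom to top.  The recursion on the
    word makes prefixing and reversing a path easy to follow. *)
Fixpoint row_widths (W : lpath) : seq nat :=
  if W is x :: W' then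
    if x == north then 0 :: row_widths W' else map succn (row_widths W')
  else [::].

Lemma size_row_widths (W : lpath) : size (row_widths W) = count_mem north W.
Proof. by elim: W => //= x W IH; case: eqP => _ /=; rewrite ?size_map IH. Qed.

Lemma row_widths_rcons (W : lpath) (x : bool) :
  row_widths (rcons W x) =
  row_widths W ++ (if x == north then [:: count_mem east W] else [::]).
Proof.
elim: W => [|y W IH] /=; first by case: x.
rewrite IH; case: y => //=; rewrite map_cat; congr cat; by case: (x).
Qed.

Lemma row_width_nth (W : lpath) (y : nat) :
  y < count_mem north W -> row_width W y = nth 0 (row_widths W) y.
Proof.
rewrite /row_width; elim: W y => // x W IH y yW; rewrite step_pos_cons //.
move: yW; case: x => /=.
  by case: y => //= y yW; rewrite -IH //; lia.
move=> yW; rewrite (nth_map 0) ?size_row_widths // -IH //.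
Qed.

Lemma path_partition_row_widths (a : nat) (W : lpath) :
  count_mem north W = a -> path_partition a W = rev (row_widths W).
Proof.
move=> Wa; apply: (@eq_from_nth _ 0) => [|i].
  by rewrite size_mkseq size_rev size_row_widths.
rewrite size_mkseq => ia; rewrite nth_mkseq // nth_rev size_row_widths ?Wa //.
by rewrite row_width_nth // Wa; lia.
Qed.

Lemma eq_bounding_path (a b : nat) (mu nu : seq nat) :
  nth 0 mu =1 nth 0 nu -> bounding_path a b mu = bounding_path a b nu.
Proof.
move=> E; rewrite /bounding_path E; congr (flatten _ ++ _).
by apply: eq_map => i; rewrite !E.
Qed.

(** The bounding path as a recursion from the bottom row upwards, started at
    abscissa [d]. *)
Fixpoint path_of_widths (b d : nat) (r : seq nat) : lpath :=
  if r is x :: r' then nseq (x - d) east ++ north :: path_of_widths b x r'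
  else nseq (b - d) east.

Lemma bounding_path_widths (b : nat) (r : seq nat) :
  bounding_path (size r) b (rev r) = path_of_widths b 0 r.
Proof.
(* The default value of nth plays the role of the starting abscissa. *)
have gen d mu :
    flatten [seq rcons (nseq (nth d mu i - nth d mu i.+1) east) north
            | i <- rev (iota 0 (size mu))] ++ nseq (b - nth d mu 0) east
    = path_of_widths b d (rev mu).
  elim/last_ind: mu d => [|mu x IH] d //=.
  rewrite rev_rcons /= -IH size_rcons -addn1 iotaD rev_cat /= add0n.
  rewrite nth_rcons ltnn eqxx [nth d _ _.+1]nth_default ?size_rcons //.
  rewrite -cats1 -!catA /=; congr (_ ++ _ :: (flatten _ ++ nseq (b - _) _)).
    apply/eq_in_map => i; rewrite mem_rev mem_iota add0n => /andP[_ im].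
    rewrite !nth_rcons im (set_nth_default x) //.
    case: ltnP => im1; first by rewrite (set_nth_default x d).
    have -> : i.+1 = size mu by apply/eqP; rewrite eqn_leq im im1.
    by rewrite eqxx [nth x mu (size mu)]nth_default.
  by case: (mu).
by rewrite -[in RHS](revK r) -gen size_rev.
Qed.

Lemma bounding_path_row_widths (a b : nat) (W : lpath) :
  count_mem north W = a -> count_mem east W = b ->
  bounding_path a b (rev (row_widths W)) = W.
Proof.
move=> <- <-; rewrite -size_row_widths bounding_path_widths.
have gen d :
    path_of_widths (d + count_mem east W) d (map (addn d) (row_widths W)) = W.
  elim: W d => [|x W IH] d /=; first by rewrite addn0 subnn.
  case: x => /=; first by rewrite add0n addn0 subnn /= IH.
  rewrite -map_comp -[in RHS](IH d.+1).
  have -> : [seq (addn d \o succn) i | i <- row_widths W]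
          = [seq d.+1 + i | i <- row_widths W] by apply: eq_map => i /=; lia.
  have -> : d + (1 + count_mem east W) = d.+1 + count_mem east W by lia.
  case: (row_widths W) => [|r rs] /=.
    by rewrite -[RHS]/(nseq _.+1 _); congr nseq; lia.
  by rewrite -[_ :: _ ++ _]/(nseq _.+1 _ ++ _); congr (nseq _ _ ++ _); lia.
rewrite -[RHS](gen 0) add0n; congr path_of_widths.
by rewrite -[LHS]map_id; apply: eq_map.
Qed.

Lemma row_widths_sorted (c : pred nat) (V : seq nat) : sorted ltn V ->
  row_widths (map c V) =
  [seq count (fun u => ~~ c u && (u < v)) V | v <- V & c v].
Proof.
elim: V => // x V IH xV.
have xmin : all (ltn x) V by apply: order_path_min xV; apply: ltn_trans.
rewrite /= IH ?(path_sorted xV) //; case cx : (c x) => /=.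
  congr cons; apply/esym/count_none => u /(allP xmin) /= xu.
  by rewrite ltnNge (ltnW xu) andbF.
rewrite -map_comp; apply/eq_in_map => v; rewrite mem_filter.
by move=> /andP[_ /(allP xmin)] /= ->; rewrite add1n.
Qed.

(** * The reverse path *)

(** Reversing a word and exchanging its two letters reflects the diagram: the
    north steps become the columns of [U] read from right to left. *)
Lemma row_widths_transpose (U : lpath) :
  rev (row_widths (rev (map negb U))) =
  mkseq (column_height (row_widths U)) (count_mem east U).
Proof.
elim: U => // x U IH.
rewrite /= rev_cons row_widths_rcons rev_cat IH; case: x => /=.
  by rewrite add0n; apply: eq_mkseq => j; rewrite /column_height.
rewrite add1n /mkseq /=; congr cons.
  rewrite count_rev count_map /column_height count_map /=.
  rewrite [RHS](eq_count (a2 := predT)) // count_predT size_row_widths.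
  by apply: eq_count; case.
rewrite (iotaDl 1 0) -map_comp; apply: eq_map => j /=.
by rewrite /column_height count_map; apply: eq_count.
Qed.

(** A path that ends with an east step fits in a square, up to that step, and
    conjugation reflects this square. *)
Lemma reverse_path_complement (n : nat) (U : lpath) :
  count_mem north U = n -> count_mem east U = n ->
  reverse_path n (rcons U east) = rcons (rev (map negb U)) east.
Proof.
move=> UN UE; have QN : count_mem north (rcons U east) = n.
  by rewrite -cats1 count_cat UN addn0.
rewrite /reverse_path path_partition_row_widths //.
have widthsE : row_widths (rcons U east) = row_widths U.
  by rewrite row_widths_rcons cats0.
rewrite widthsE; set W := rcons _ _; have WN : count_mem north W = n.
  rewrite /W -cats1 count_cat count_rev count_map addn0 -UE.
  by apply: eq_count; case.
have WE : count_mem east W = n.+1.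
  rewrite /W -cats1 count_cat count_rev count_map addn1 -UN; congr S.
  by apply: eq_count; case.
rewrite -[RHS](bounding_path_row_widths WN WE); apply: eq_bounding_path => i.
have -> : row_widths W = row_widths (rev (map negb U)).
  by rewrite row_widths_rcons cats0.
rewrite row_widths_transpose /conjugate UE.
set w := row_widths U.
have heightE j : column_height (rev w) j = column_height w j.
  by rewrite /column_height count_rev.
have w_sorted : sorted leq w.
  rewrite /w; elim: (U) => //= x V IH; case: (x == north) => /=.
    by rewrite path_min_sorted //; apply/allP.
  by rewrite sorted_map; apply: sub_sorted IH => u v.
have w_le : all (fun r => r <= n) w.
  rewrite -UE /w; elim: (U) => //= x V IH; case: x => /=.
    by rewrite add0n.
  by rewrite all_map; apply: sub_all IH => r /=; rewrite add1n.
(* The conjugate has as many parts as the largest width, so both sides vanish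
   from there on. *)
have [iw|wi] := ltnP i (nth 0 (rev w) 0).
  rewrite nth_mkseq // heightE nth_mkseq //; apply: leq_trans iw _.
  case E : (rev w) => [|r s] //=; move/allP: w_le => -> //.
  by rewrite -mem_rev E mem_head.
rewrite nth_default ?size_mkseq //; have [im|mi] := ltnP i n; last first.
  by rewrite nth_default ?size_mkseq.
rewrite nth_mkseq //; apply/esym/count_none => r; rewrite -mem_rev -leqNgt.
move=> rw; apply: leq_trans wi.
have := w_sorted; rewrite -rev_sorted; case: (rev w) rw => // r0 s rs /=.
have geq_trans : transitive (fun x y => y <= x).
  by move=> y x z xy yz; apply: leq_trans yz xy.
move=> /(order_path_min geq_trans)/allP r0_max.
by move: rs; rewrite inE => /predU1P[->|/r0_max].
Qed.

Lemma dyck_last (n : nat) (Q : lpath) : dyck n n.+1 Q ->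
  exists U,
    [/\ Q = rcons U east, count_mem north U = n & count_mem east U = n].
Proof.
case/and3P=> /eqP cN /eqP cE /allP below.
case: (lastP Q) cN cE below => // U x; rewrite -cats1 !count_cat.
case: x => cN cE below; rewrite /= ?addn0 ?addn1 in cN cE.
  have := below (size U); rewrite mem_iota size_cat addn1 ltnS leqnSn.
  rewrite /xcoord /ycoord take_size_cat // cE -[X in X * n.+1]cN => /(_ isT).
  by rewrite mulnC leq_pmul2l // ltnn.
by exists U; rewrite cats1; split=> //; case: cE.
Qed.

(** * Hook lengths of a partition given by its first column *)

(** The partition with first-column hooks [H] is read off the characteristic
    word of [H]: each member of [H] is a row, each gap a column, and a row meets
    the columns of the smaller gaps. *)
Definition gaps (H : seq nat) (t : nat) : nat :=
  count (fun g => g \notin H) (iota 0 t).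

Section Gaps.

Variable H : seq nat.

Lemma gapsS (t : nat) : gaps H t.+1 = gaps H t + (t \notin H).
Proof. by rewrite /gaps -addn1 iotaD count_cat /= addn0. Qed.

Lemma leq_gaps (s t : nat) : s <= t -> gaps H s <= gaps H t.
Proof. by move=> /subnK<-; rewrite addnC /gaps iotaD count_cat leq_addr. Qed.

Lemma ltn_gaps (g t : nat) : g \notin H -> (gaps H g < gaps H t) = (g < t).
Proof.
move=> gH; apply/idP/idP => [|/leq_gaps]; last by rewrite gapsS gH addn1.
by rewrite !ltnNge; apply: contra => /leq_gaps.
Qed.

Lemma iota_gaps (t : nat) :
  iota 0 (gaps H t) = [seq gaps H g | g <- iota 0 t & g \notin H].
Proof.
elim: t => // t IH; rewrite gapsS -[t.+1]addn1 !iotaD filter_cat map_cat -IH /=.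
by case: (t \notin H).
Qed.

Let hs := sort geq (undup H).

Lemma mem_sorted_hooks : hs =i H.
Proof. by move=> t; rewrite mem_sort mem_undup. Qed.

Lemma sorted_hooks_gtn : sorted gtn hs.
Proof.
rewrite (gtn_sorted_uniq_geq hs) sort_uniq undup_uniq /=.
by apply: sort_sorted => x y; rewrite leq_total.
Qed.

Lemma gaps_count_hooks (t : nat) : gaps H t + count (fun h => h < t) hs = t.
Proof.
rewrite -[RHS](size_iota 0 t) -(count_predC [in H]) addnC; congr (_ + _).
rewrite -!size_filter; apply: perm_size; apply: uniq_perm.
- by rewrite filter_uniq // sort_uniq undup_uniq.
- by rewrite filter_uniq // iota_uniq.
- by move=> x; rewrite !mem_filter mem_sorted_hooks mem_iota andbC.
Qed.

Lemma partition_of_hooks_gaps : partition_of_hooks H = map (gaps H) hs.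
Proof.
apply: (@eq_from_nth _ 0) => [|i]; rewrite size_mkseq ?size_map // => ih.
rewrite nth_mkseq // (nth_map 0) // -(count_ltn_nth sorted_hooks_gtn ih).
by rewrite -[X in X - _](gaps_count_hooks (nth 0 hs i)) addnK.
Qed.

(** The box in the row of the hook [h] and in the column of the gap [g] has
    hook length [h - g]: the arm counts the gaps and the leg the hooks that lie
    strictly between [g] and [h]. *)
Lemma hook_length_gaps (i g : nat) :
  i < size hs -> g \notin H -> g < nth 0 hs i ->
  hook_length (partition_of_hooks H) i (gaps H g) = nth 0 hs i - g.
Proof.
move=> ih gH gi; rewrite /hook_length partition_of_hooks_gaps (nth_map 0) //.
have -> : column_height (map (gaps H) hs) (gaps H g) =
          count (fun h => g < h) hs.
  rewrite /column_height count_map; apply: eq_count => h /=.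
  exact: ltn_gaps.
have hi := gaps_count_hooks (nth 0 hs i); have hg := gaps_count_hooks g.
rewrite (count_ltn_nth sorted_hooks_gtn ih) in hi.
have total : count (fun h => h < g) hs + count (fun h => g < h) hs = size hs.
  rewrite -(count_predC (fun h => h < g)); congr addn; apply: eq_in_count => h.
  rewrite mem_sorted_hooks /= -leqNgt [in RHS]leq_eqVlt => hH.
  by case: eqP => // E; rewrite E hH in gH.
have lt : gaps H g < gaps H (nth 0 hs i) by rewrite ltn_gaps.
have below : count (fun h => h < g) hs <= count (fun h => h < nth 0 hs i) hs.
  by apply: sub_count => h /= /ltn_trans; apply.
rewrite (count_ltn_nth sorted_hooks_gtn ih) in below.
lia.
Qed.

Lemma boundary_boxes_gaps (b i : nat) :
  0 < b -> i < size hs ->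
  (forall h, h \in H -> b <= h -> h - b \in H) ->
  boundary_boxes b (partition_of_hooks H) i =
  gaps H (nth 0 hs i) - gaps H (nth 0 hs i - b).
Proof.
move=> b0 ih Hb; rewrite /boundary_boxes; set h := nth 0 hs i.
have hH : h \in H by rewrite -mem_sorted_hooks mem_nth.
have -> : nth 0 (partition_of_hooks H) i = gaps H h.
  by rewrite partition_of_hooks_gaps (nth_map 0).
rewrite iota_gaps count_map count_filter.
have -> : count (predI (preim (gaps H)
    (fun j => hook_length (partition_of_hooks H) i j < b))
    (fun g => g \notin H)) (iota 0 h) =
    count (fun g => (g \notin H) && (h < g + b)) (iota 0 h).
  apply: eq_in_count => g; rewrite mem_iota add0n => /andP[_ gh] /=.
  case gH: (g \in H); rewrite /= ?andbF // andbT hook_length_gaps ?gH //; lia.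
have split_h : h - b + (h - (h - b)) = h by lia.
have iota_h : iota 0 h = iota 0 (h - b) ++ iota (h - b) (h - (h - b)).
  by rewrite -[in LHS]split_h iotaD add0n.
rewrite [gaps H h]/gaps iota_h !count_cat -/(gaps H _) addKn.
rewrite count_none ?add0n; last by move=> g; rewrite mem_iota; lia.
(* The gap g = h - b would give a hook of length b, but h - b is not a gap. *)
apply: eq_in_count => g; rewrite mem_iota => gb.
have [gE|gE] := eqVneq (g + b) h; last by case: (g \in H) => //=; lia.
by rewrite (_ : g = h - b) ?Hb //; lia.
Qed.

Lemma column_height_hooks :
  0 \notin H -> column_height (partition_of_hooks H) 0 = size hs.
Proof.
by move=> H0; rewrite -[hs](first_column_hooks_partition H0) size_map size_iota.
Qed.

Lemma first_column_hook_length (i : nat) :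
  0 \notin H -> i < size hs ->
  hook_length (partition_of_hooks H) i 0 = nth 0 hs i.
Proof.
move=> H0 ih; rewrite -[hs](first_column_hooks_partition H0).
by rewrite (nth_map 0) ?nth_iota ?size_iota // column_height_hooks.
Qed.

(** As [H] is stable under subtraction of [a], a hook is the largest of its
    class modulo [a] as soon as adding [a] once leaves [H]. *)
Lemma boundary_boxes_mrows (a b : nat) :
  0 < a -> 0 < b -> 0 \notin H ->
  (forall h q, h + q * a \in H -> h \in H) ->
  (forall h, h \in H -> b <= h -> h - b \in H) ->
  [seq boundary_boxes b (partition_of_hooks H) i
  | i <- mrows a (partition_of_hooks H)] =
  [seq gaps H h - gaps H (h - b) | h <- hs & h + a \notin H].
Proof.
move=> a0 b0 H0 Ha Hb; rewrite /mrows first_column_hooks_partition // -/hs.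
rewrite column_height_hooks //.
have -> : [seq i <- iota 0 (size hs) | all (fun h =>
       (h == hook_length (partition_of_hooks H) i 0 %[mod a]) ==>
       (h <= hook_length (partition_of_hooks H) i 0)) hs]
   = [seq i <- iota 0 (size hs) | nth 0 hs i + a \notin H].
  apply: eq_in_filter => i; rewrite mem_iota add0n => /andP[_ ih].
  rewrite first_column_hook_length //; apply/allP/idP => [maxi|top h].
    apply/negP; rewrite -mem_sorted_hooks => /maxi.
    by rewrite modnDr eqxx /=; lia.
  rewrite mem_sorted_hooks => hH; apply/implyP => /eqP hi.
  rewrite leqNgt; apply: contra top => lt.
  have /dvdnP[[|q] hq] : a %| h - nth 0 hs i.
    by rewrite -eqn_mod_dvd ?hi // ltnW.
  - by move: hq lt; rewrite mul0n; lia.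
  - apply: (Ha _ q).
    by rewrite -addnA -mulSn -hq subnKC // ltnW.
rewrite -[in RHS](mkseq_nth 0 hs) /mkseq filter_map -map_comp.
apply/eq_in_map => i; rewrite mem_filter mem_iota add0n => /and3P[_ _ ih] /=.
exact: boundary_boxes_gaps.
Qed.

End Gaps.

(** * Levels of the points of a Dyck path *)

Section Sweep.

Variables (n : nat) (P : lpath).
Hypotheses (n_gt0 : 0 < n) (P_dyck : dyck n n.+1 P).

Local Notation H := (positive_hooks n n.+1 P).

(** By [dyck_below] the subtraction does not truncate. *)
Definition level (k : nat) : nat := n.+1 * ycoord P k - n * xcoord P k.

Lemma dyck_counts : count_mem north P = n /\ count_mem east P = n.+1.
Proof. by case/and3P: P_dyck => /eqP-> /eqP->. Qed.

Lemma dyck_size : size P = n + n.+1.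
Proof.
by rewrite -count_east_north; case: dyck_counts => -> ->; rewrite addnC.
Qed.

Lemma dyck_below (k : nat) : k <= size P -> n * xcoord P k <= n.+1 * ycoord P k.
Proof.
by case/and3P: P_dyck => _ _ /allP h kP; apply: h; rewrite mem_iota.
Qed.

Lemma coord_max (k : nat) : xcoord P k <= n.+1 /\ ycoord P k <= n.
Proof.
case: dyck_counts => <- <-.
split; rewrite -[X in _ <= count_mem _ X](cat_take_drop k) count_cat;
  exact: leq_addr.
Qed.

Lemma coord_end : xcoord P (size P) = n.+1 /\ ycoord P (size P) = n.
Proof. by case: dyck_counts; rewrite /xcoord /ycoord take_size. Qed.

Lemma ycoord_north (k : nat) :
  k < size P -> nth north P k = north -> ycoord P k < n.
Proof.
move=> kP kN; have [_] := coord_max k.+1; have [_ ->] := coordS kP.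
by rewrite kN /= addn1.
Qed.

Lemma level0 : level 0 = 0.
Proof. by rewrite /level /xcoord /ycoord take0 /= !muln0. Qed.

Lemma level_end : level (size P) = 0.
Proof. by rewrite /level; case: coord_end => -> ->; rewrite mulnC subnn. Qed.

Lemma level_north (k : nat) : k < size P -> nth north P k = north ->
  level k.+1 = level k + n.+1.
Proof.
move=> kP kN; have := dyck_below (ltnW kP); have [] := coordS kP.
by rewrite /level kN => -> ->; rewrite /= addn0 addn1 mulnS; lia.
Qed.

Lemma level_east (k : nat) : k < size P -> nth north P k = east ->
  level k = level k.+1 + n.
Proof.
move=> kP kN; have := dyck_below kP; have [] := coordS kP.
by rewrite /level kN => -> ->; rewrite /= addn0 addn1 mulnS; lia.
Qed.

(** Equal levels mean that [n] divides the difference of the heights, as [n]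
    and [n.+1] are coprime; this difference is at most [n]. *)
Lemma level_inj (i j : nat) :
  i < j -> j <= size P -> level i = level j -> i = 0 /\ j = size P.
Proof.
move=> ij jP; rewrite /level => E.
have iP : i <= size P by lia.
have := dyck_below iP; have := dyck_below jP.
have [lx ly] := leq_coord P (ltnW ij).
have sj := coord_sum jP; have si := coord_sum iP.
have [mx my] := coord_max j; have := dyck_size.
move=> sz bj bi.
have D : n.+1 * (ycoord P j - ycoord P i) = n * (xcoord P j - xcoord P i).
  by rewrite !mulnBr; lia.
have : n %| ycoord P j - ycoord P i.
  by rewrite -(@Gauss_dvdr n n.+1) ?coprimenS // D dvdn_mulr.
case/dvdnP => [[|[|q]]] hq; [|split; nia..].
rewrite hq mul0n muln0 in D; move/esym/eqP: D.
rewrite muln_eq0; lia.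
Qed.

Lemma north_step_at (y : nat) : y < n ->
  exists k, [/\ k < size P, nth north P k = north & ycoord P k = y].
Proof.
by case: dyck_counts => <- _ /step_posP[? ? ?]; exists (step_pos north P y).
Qed.

Lemma east_step_at (x : nat) : x <= n ->
  exists k, [/\ k < size P, nth north P k = east & xcoord P k = x].
Proof.
rewrite -ltnS; case: dyck_counts => _ <- /step_posP[? ? ?].
by exists (step_pos east P x).
Qed.

(** * Positive hooks and levels *)

(** A box below the path lies to the right of a north step, in its row, and
    moving one column to the right lowers the filling by [n]. *)
Lemma hooks_northP (t : nat) : reflect
  (exists k i, [/\ k < size P, nth north P k = north & level k = t + n * i.+1])
  (t \in H).
Proof.
apply: (iffP mapP) => [[[x y]]|[k [i [kP kN E]]]].
  rewrite mem_filter => /andP[wxy] /allpairsPdep[x' [y' []]].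
  rewrite !mem_iota add0n => /andP[x1 xb] /andP[_ yn] [? ?]; subst x' y'.
  case/andP: wxy => /= wx xy.
  move=> ->; rewrite /row_width in wx; case: dyck_counts => cN _.
  have := yn; rewrite -[X in _ < X]cN => /step_posP.
  move: wx; set k := step_pos _ _ _ => wx [kP kN ky].
  exists k, (x - xcoord P k).-1; split=> //.
  rewrite prednK ?subn_gt0 // mulnBr /level.
  rewrite -[ycoord P k]/(count_mem north (take k P)) ky.
  have : n * xcoord P k <= n * x by rewrite leq_mul2l ltnW ?orbT.
  by lia.
have [mx my] := coord_max k.
have b0 := dyck_below (ltnW kP).
have yn := ycoord_north kP kN.
rewrite /level in E.
have tE : t + n * (xcoord P k + i.+1) = n.+1 * ycoord P k.
  by rewrite mulnDr; lia.
(* The filling 0 is excluded: only points on the diagonal of the grid have level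
   0, and these are its two corners. *)
have t0 : 0 < t.
  rewrite lt0n; apply/eqP => t0; rewrite t0 add0n in tE.
  have : n %| ycoord P k.
    by rewrite -(@Gauss_dvdr n n.+1) ?coprimenS // -tE dvdn_mulr.
  have [y0|y0] := posnP (ycoord P k); last by move/(dvdn_leq y0); lia.
  by move: tE; rewrite y0 muln0 => /eqP; rewrite muln_eq0 addnS; lia.
exists (xcoord P k + i.+1, ycoord P k); last by rewrite /= -tE addnK.
rewrite mem_filter -[_.1]/(xcoord P k + i.+1) -[_.2]/(ycoord P k) -tE.
have -> : row_width P (ycoord P k) = xcoord P k.
  by rewrite /row_width step_pos_count.
apply/andP; split; first by lia.
apply/allpairsPdep; exists (xcoord P k + i.+1), (ycoord P k); split=> //.
  rewrite mem_iota addnS add1n /= ltnS -addnS -(leq_pmul2l n_gt0).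
  have : n.+1 * ycoord P k <= n.+1 * n by rewrite leq_mul2l ltnW ?orbT.
  by rewrite -tE [n.+1 * n]mulnC; lia.
by rewrite mem_iota.
Qed.

(** The same boxes, seen from the east step that lies above them in their
    column; moving one row down lowers the filling by [n.+1]. *)
Lemma hooks_eastP (t : nat) : reflect
  (exists m j, [/\ m < size P, nth north P m = east &
     level m.+1 = t + n.+1 * j.+1])
  (t \in H).
Proof.
apply: (iffP (hooks_northP t)) => [[k [i [kP kN E]]]|[m [j [mP mE E]]]].
  have b0 := dyck_below (ltnW kP).
  have yn := ycoord_north kP kN.
  rewrite /level in E.
  (* The box with filling t is the (i + 1)-st one to the right of step k. *)
  have [|m [mP mE mx]] := @east_step_at (xcoord P k + i); first by nia.
  have km : k < m.
    rewrite ltnNge; apply/negP; rewrite leq_eqVlt => /predU1P[mk|mk].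
      by rewrite mk kN in mE.
    have [h _] := leq_coord P mk; have [h' _] := coordS mP.
    by rewrite mE /= in h'; lia.
  have [_ yk] := coordS kP; rewrite kN /= addn1 in yk.
  have [_ ykm] := leq_coord P km.
  exists m, (ycoord P m - ycoord P k.+1); split=> //.
  have bm := dyck_below mP; rewrite /level.
  have [xm ym] := coordS mP; rewrite mE in xm ym.
  rewrite xm ym /= in bm *.
  have -> : (ycoord P m - ycoord P k.+1).+1 = ycoord P m - ycoord P k by lia.
  have : n.+1 * ycoord P k <= n.+1 * ycoord P m by rewrite leq_mul2l; lia.
  by rewrite mulnBr; nia.
have bm := dyck_below mP; rewrite /level in E.
have [xm ym] := coordS mP; rewrite mE /= addn0 addn1 in xm ym.
rewrite xm ym in bm E.
have [Mx My] := coord_max m; have [Mx' _] := coord_max m.+1.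
have lt : j.+1 < ycoord P m by nia.
(* The box with filling t is the (j + 1)-st one below step m. *)
have [|k [kP kN ky]] := @north_step_at (ycoord P m - j.+1); first by lia.
have [_ yk] := coordS kP; rewrite kN ky /= addn1 in yk.
have km : k < m.
  rewrite ltnNge; apply/negP => mk.
  by have [_ h] := leq_coord P mk; lia.
have [h _] := leq_coord P (ltnW km).
exists k, (xcoord P m - xcoord P k); split=> //.
have bk := dyck_below (ltnW kP); rewrite /level ky in bk *.
have -> : n * (xcoord P m - xcoord P k).+1 =
          n * xcoord P m + n - n * xcoord P k.
  by rewrite mulnS mulnBr addnBA ?leq_mul2l ?h ?orbT // addnC.
have : n * xcoord P k <= n * xcoord P m by rewrite leq_mul2l h orbT.
by rewrite mulnBr; lia.
Qed.

Lemma zero_notin_hooks : 0 \notin H.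
Proof.
apply/negP => /mapP[[x y]]; rewrite mem_filter => /andP[/andP[/= _ xy] _]; lia.
Qed.

Lemma hooks_sub_north (t q : nat) : t + q * n \in H -> t \in H.
Proof.
move=> /hooks_northP[k [i [kP kN E]]]; apply/hooks_northP.
by exists k, (q + i); split=> //; rewrite E -addnA mulnC -mulnDr addnS.
Qed.

Lemma hooks_sub_east (t q : nat) : t + q * n.+1 \in H -> t \in H.
Proof.
move=> /hooks_eastP[k [i [kP kN E]]]; apply/hooks_eastP.
by exists k, (q + i); split=> //; rewrite E -addnA [q * _]mulnC -mulnDr addnS.
Qed.

(** The level determines the point of the grid except for the two corners, so a
    point of the path is not the southeast corner of a box below the path. *)
Lemma level_notin_hooks (m : nat) : m <= size P -> level m \notin H.
Proof.
move=> mP; apply/negP => /hooks_northP[k [i [kP kN E]]].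
have bk := dyck_below (ltnW kP); have bm := dyck_below mP.
rewrite /level in E.
have [Mx My] := coord_max m.
have D : n.+1 * ycoord P k + n * xcoord P m =
         n.+1 * ycoord P m + n * (xcoord P k + i.+1) by rewrite mulnDr; lia.
have yk := ycoord_north kP kN.
have [lt|le] := ltnP (ycoord P m) (ycoord P k).
  have : n %| ycoord P k - ycoord P m.
    rewrite -(@Gauss_dvdr n n.+1) ?coprimenS // mulnBr.
    have -> : n.+1 * ycoord P k - n.+1 * ycoord P m =
              n * (xcoord P k + i.+1) - n * xcoord P m by lia.
    by rewrite -mulnBr dvdn_mulr.
  by move/dvdn_leq; lia.
have D' : n.+1 * (ycoord P m - ycoord P k) + n * (xcoord P k + i.+1) =
          n * xcoord P m.
  have : n.+1 * ycoord P k <= n.+1 * ycoord P m by rewrite leq_mul2l le orbT.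
  by rewrite mulnBr; lia.
have : n %| ycoord P m - ycoord P k.
  rewrite -(@Gauss_dvdr n n.+1) ?coprimenS //.
  rewrite -(dvdn_addl _ (dvdn_mulr (xcoord P k + i.+1) (dvdnn n))).
  by rewrite D' dvdn_mulr.
case/dvdnP => [[|q]] hq.
  rewrite hq mul0n muln0 add0n in D'.
  move/eqP: D'; rewrite eqn_pmul2l // => /eqP D'.
  have [km|mk] := ltnP k m; last by have [h _] := leq_coord P mk; lia.
  have [_ h] := leq_coord P km; have [_ h'] := coordS kP.
  by rewrite kN /= addn1 in h'; lia.
have : n * n.+1 < n * xcoord P m.
  have : n <= ycoord P m - ycoord P k by rewrite hq mulSn leq_addr.
  rewrite -(leq_pmul2l (ltn0Sn n)) -D' mulnDr => h.
  by rewrite [n * n.+1]mulnC mulnS; lia.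
by rewrite ltn_pmul2l // ltnNge Mx.
Qed.

(** The types of the steps leaving and reaching a level of the path, extended
    to all natural numbers. *)
Definition out_north (v : nat) : bool := (v < n) || (v - n \in H).
Definition in_east (v : nat) : bool := (v < n.+1) || (v - n.+1 \in H).

(** This shift, which makes the pair [n], [n.+1] special, links the departures
    at one level to the arrivals at the next. *)
Lemma in_eastS (v : nat) : in_east v.+1 = out_north v.
Proof. by rewrite /in_east /out_north ltnS subSS. Qed.

Lemma out_north_level (k : nat) :
  k < size P -> out_north (level k) = nth north P k.
Proof.
move=> kP; rewrite /out_north; case E : (nth north P k).
  case: ltnP => //= nk; apply/hooks_northP; exists k, 0; split=> //.
  by rewrite muln1 subnK.
rewrite (level_east kP E) addnK (negPf (level_notin_hooks kP)) orbF.
by rewrite ltnNge leq_addl.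
Qed.

Lemma in_east_level (k : nat) :
  k < size P -> in_east (level k.+1) = ~~ nth north P k.
Proof.
move=> kP; rewrite /in_east; case E : (nth north P k).
  rewrite (level_north kP E) addnK (negPf (level_notin_hooks (ltnW kP))) orbF.
  by rewrite ltnNge leq_addl.
case: ltnP => //= nk; apply/hooks_eastP; exists k, 0; split=> //.
by rewrite muln1 subnK.
Qed.

(** When [v < n], the point [(v, v)] has level [v].  The north step at height
    [v] starts there or on its left, and in the latter case [v] is a positive
    hook. *)
Lemma out_north_start (v : nat) : v \notin H -> out_north v ->
  exists2 k, k < size P & level k = v.
Proof.
rewrite /out_north => vH.
case: ltnP => /= [vn _|nv /hooks_northP[k [i [kP kN E]]]].
  have [k [kP kN ky]] := north_step_at vn.
  have bk := dyck_below (ltnW kP); have := erefl (level k).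
  rewrite {1}/level ky mulSn => E; rewrite ky in bk.
  have xv : xcoord P k <= v by rewrite -ltnS -(ltn_pmul2l n_gt0) mulnS; lia.
  case: (ltngtP (xcoord P k) v) xv => // [xv|xv] _.
    case/negP: vH; apply/hooks_northP; exists k, (v - xcoord P k).-1.
    split=> //; rewrite prednK ?subn_gt0 // mulnBr.
    have : n * xcoord P k <= n * v by rewrite leq_mul2l ltnW ?orbT.
    lia.
  by exists k => //; rewrite -E xv; lia.
case: i E => [|i] E; first by exists k => //; rewrite E muln1 subnK.
case/negP: vH; apply/hooks_northP; exists k, i; split=> //.
by rewrite E [n * i.+2]mulnS addnA subnK.
Qed.

(** When [0 < v <= n], the east step that arrives at abscissa [v] ends at
    [(v, v)], or above it, and then [v] is a positive hook. *)
Lemma in_east_end (v : nat) : v \notin H -> in_east v ->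
  exists2 k, k < size P & level k = v.
Proof.
move=> vH dv.
(* The end of the last step has the level of the start of the first one. *)
have startP m : m < size P -> level m.+1 = v ->
    exists2 k, k < size P & level k = v.
  move=> mP E; have [lt|ge] := ltnP m.+1 (size P); first by exists m.+1.
  exists 0; first by apply: leq_ltn_trans mP.
  by rewrite level0 -E (_ : m.+1 = size P) ?level_end //; lia.
move: dv; rewrite /in_east.
case: ltnP => /= [vn _|nv /hooks_eastP[k [i [kP kN E]]]].
  case: v vn vH startP => [|v] vn vH startP.
    by exists 0; rewrite ?level0 // dyck_size; lia.
  have [|k [kP kN kx]] := @east_step_at v; first by lia.
  have bk := dyck_below kP; have := erefl (level k.+1).
  have [xk yk] := coordS kP; rewrite kN /= addn0 addn1 in xk yk.
  rewrite {1}/level xk kx => E; rewrite xk kx in bk.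
  have yv : v < ycoord P k.+1 by rewrite ltnNge; apply/negP => h; nia.
  case: (ltngtP v.+1 (ycoord P k.+1)) yv => // [yv|yv] _.
    case/negP: vH; apply/hooks_eastP; exists k, (ycoord P k.+1 - v.+1).-1.
    split=> //; rewrite prednK ?subn_gt0 // mulnBr.
    have : n.+1 * v.+1 <= n.+1 * ycoord P k.+1 by rewrite leq_mul2l ltnW.
    by rewrite [n.+1 * v.+1]mulSn; lia.
  by apply: (startP k) => //; rewrite -E -yv; rewrite mulSn; lia.
case: i E => [|i] E; first by apply: (startP k) => //; rewrite E muln1 subnK.
case/negP: vH; apply/hooks_eastP; exists k, i; split=> //.
by rewrite E [n.+1 * i.+2]mulnS addnA subnK.
Qed.

Lemma out_north_hook (v : nat) : v \in H -> out_north v.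
Proof.
rewrite /out_north; case: ltnP => //= nv vH.
by apply: (@hooks_sub_north _ 1); rewrite mul1n subnK.
Qed.

Lemma in_east_hook (v : nat) : v \in H -> in_east v.
Proof.
rewrite /in_east; case: ltnP => //= nv vH.
by apply: (@hooks_sub_east _ 1); rewrite mul1n subnK.
Qed.

Definition levels : seq nat := mkseq level (size P).
Definition sorted_levels : seq nat := sort leq levels.
Local Notation V := sorted_levels.

Lemma mem_levels (v : nat) :
  reflect (exists2 k, k < size P & level k = v) (v \in V).
Proof.
rewrite mem_sort; apply: (iffP mapP) => [[k]|[k kP <-]].
  by rewrite mem_iota => kP ->; exists k.
by exists k; rewrite // mem_iota.
Qed.

Lemma perm_levels : perm_eq V levels.
Proof. by rewrite perm_sort. Qed.

Lemma uniq_levels : uniq V.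
Proof.
rewrite sort_uniq map_inj_in_uniq ?iota_uniq // => i j.
rewrite !mem_iota !add0n /= => iP jP E; case: (ltngtP i j) => // ij.
  by have [_] := level_inj ij (ltnW jP) E; lia.
by have [_] := level_inj ij (ltnW iP) (esym E); lia.
Qed.

Lemma sorted_levels_ltn : sorted ltn V.
Proof.
by rewrite ltn_sorted_uniq_leq uniq_levels sort_sorted //; apply: leq_total.
Qed.

Lemma perm_levels_end : perm_eq V (mkseq (fun k => level k.+1) (size P)).
Proof.
apply: perm_trans perm_levels _; rewrite /levels.
have := level_end; case: (size P) => [|s] // E.
rewrite /mkseq -[in X in perm_eq _ X]addn1 iotaD map_cat cats1 /= E.
by rewrite perm_sym perm_rcons level0 (iotaDl 1 0) -map_comp.
Qed.

Lemma out_north_nonvertex (w : nat) : w \notin V -> out_north w = in_east w.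
Proof.
have [wH|wH] := boolP (w \in H); first by rewrite out_north_hook ?in_east_hook.
move=> /mem_levels wV; apply/idP/idP => h; case: wV.
  exact: out_north_start.
exact: in_east_end.
Qed.

(** The numbers strictly between two consecutive levels are not levels, so from
    each to the next [out_north u.+1 = in_east u.+1 = out_north u]. *)
Lemma in_east_next (i : nat) : i.+1 < size V ->
  in_east (nth 0 V i.+1) = out_north (nth 0 V i).
Proof.
move=> iV; have lt : nth 0 V i < nth 0 V i.+1.
  apply: (sorted_ltn_nth ltn_trans 0 sorted_levels_ltn);
    by rewrite ?inE ?(ltnW iV).
suff same u : nth 0 V i <= u -> u < nth 0 V i.+1 ->
    out_north u = out_north (nth 0 V i).
  by rewrite -(ltn_predK lt) in_eastS same //; lia.
elim: u => [|u IH]; first by rewrite leqn0 => /eqP->.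
rewrite leq_eqVlt => /predU1P[-> //|iu ui].
rewrite out_north_nonvertex ?in_eastS ?IH ?(ltnW ui) //.
apply/negP => /(nthP 0)[j jV E].
have mono := sorted_ltn_nth ltn_trans 0 sorted_levels_ltn.
have [ji|ij] := leqP j i.
  have [E'|lt'] := eqVneq j i; first by move: iu; rewrite -E E' ltnn.
  have : nth 0 V j < nth 0 V i.
    by apply: mono => //; rewrite ?inE ?(ltnW iV) // ltn_neqAle lt'.
  by rewrite E; lia.
have [E'|lt'] := eqVneq j i.+1; first by move: ui; rewrite -E E' ltnn.
have : nth 0 V i.+1 < nth 0 V j.
  by apply: mono => //; rewrite ltn_neqAle eq_sym lt'.
by rewrite E; lia.
Qed.

(** * Zeta lists the steps by increasing level *)

Definition easts_below (t : nat) : nat :=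
  count (fun v => ~~ out_north v && (v < t)) V.

Definition sweep : lpath := map out_north V.

(** The gaps of each class modulo [n.+1] are the terms of an arithmetic
    progression that starts at the end of an east step.  So among the [n.+1]
    numbers just below [t] there is one gap for each east step that ends below
    [t]. *)
Lemma gaps_window (t : nat) :
  gaps H t = gaps H (t - n.+1) + count (fun v => in_east v && (v < t)) V.
Proof.
elim: t => [|t IH].
  by rewrite /gaps /= count_none // => v _; rewrite andbF.
have -> : count (fun v => in_east v && (v < t.+1)) V =
    count (fun v => in_east v && (v < t)) V + (in_east t && (t \notin H)).
  have -> : (in_east t && (t \notin H) : nat) =
      count (fun v => in_east v && (v == t)) V.
    case E : (in_east t) => /=; last first.
      by rewrite count_none // => v _; case: eqP => [->|]; rewrite ?E ?andbF.
    rewrite -(eq_count (a1 := pred1 t)) => [|v /=]; last first.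
      by case: eqP => [->|]; rewrite ?E ?andbF.
    rewrite (count_uniq_mem _ uniq_levels); congr nat_of_bool.
    apply/idP/mem_levels => [tH|[k kP <-]]; first exact: in_east_end.
    by apply: level_notin_hooks; apply: ltnW.
  rewrite -count_predUI [X in _ + X]count_none ?addn0 => [|v _ /=]; last first.
    by case: (ltngtP v t); rewrite ?andbF.
  by apply: eq_count => v /=; rewrite ltnS leq_eqVlt -andb_orr orbC.
rewrite gapsS IH.
have -> : gaps H (t.+1 - n.+1) = gaps H (t - n.+1) + ~~ in_east t.
  rewrite /in_east; case: ltnP => nt /=.
    by rewrite addn0; congr gaps; lia.
  by rewrite -gapsS; congr gaps; lia.
case tH : (t \in H) => /=; first by rewrite (in_east_hook tH) /= !addn0.
by case: (in_east t) => /=; lia.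
Qed.

(** An east step starts [n] above its end. *)
Lemma easts_below_hook (h : nat) :
  count (fun v => in_east v && (v < h)) V = easts_below (h + n).
Proof.
rewrite /easts_below (permP perm_levels_end) (permP perm_levels).
rewrite !count_map; apply: eq_in_count => k; rewrite mem_iota add0n => kP /=.
rewrite in_east_level // out_north_level //.
case E : (nth north P k) => //=; rewrite (level_east kP E).
by rewrite ltn_add2r.
Qed.

Lemma easts_below_small (t : nat) : t <= n -> easts_below t = 0.
Proof.
by move=> tn; apply: count_none => v _; rewrite /out_north; lia.
Qed.

Lemma count_out_north : count out_north V = n.
Proof.
rewrite (permP perm_levels) count_map -[RHS](proj1 dyck_counts).
rewrite -[in RHS](mkseq_nth north P) count_map; apply: eq_in_count => k.
by rewrite mem_iota => kP /=; rewrite out_north_level //; case: (nth north P k).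
Qed.

(** The hook [h] of an [n]-row and the start of the corresponding north step
    differ by [n].  The north steps that start below level [n] give no row of
    the core, but no east step starts below them: they account for the padding
    zeros. *)
Lemma zeta_partition_sweep :
  zeta_partition n n.+1 P = rev (row_widths sweep).
Proof.
rewrite (row_widths_sorted _ sorted_levels_ltn) -/(easts_below _).
rewrite -[X in rev X]/(map easts_below _).
have rows : perm_eq [seq h + n | h <- sort geq (undup H) & h + n \notin H]
                    [seq v <- V | out_north v && (n <= v)].
  apply: uniq_perm.
  - rewrite map_inj_uniq => [|x y /addIn //].
    by rewrite filter_uniq // sort_uniq undup_uniq.
  - by rewrite filter_uniq // uniq_levels.
  move=> v; rewrite mem_filter; apply/mapP/andP => [[h]|[/andP[ov nv] vV]].
    rewrite mem_filter mem_sorted_hooks => /andP[hH hh] ->.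
    have oh : out_north (h + n) by rewrite /out_north addnK hh orbT.
    rewrite oh leq_addl; split=> //; apply/mem_levels.
    exact: out_north_start.
  exists (v - n); last by rewrite subnK.
  rewrite mem_filter mem_sorted_hooks subnK //.
  move: ov; rewrite /out_north ltnNge nv /= => ->; rewrite andbT.
  by case/mem_levels: vV => k kP <-; rewrite level_notin_hooks // ltnW.
rewrite /zeta_partition /core.
rewrite boundary_boxes_mrows ?zero_notin_hooks //; last 2 first.
- by move=> h q; apply: hooks_sub_north.
- by move=> h hH nh; apply: (@hooks_sub_east _ 1); rewrite mul1n subnK.
set s := sort geq _.
have sE : perm_eq s [seq easts_below v | v <- V & out_north v && (n <= v)].
  rewrite /s perm_sort -(permPr (perm_map easts_below rows)) -map_comp.
  rewrite (eq_map (g := easts_below \o addn^~ n)) // => h /=.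
  by rewrite gaps_window addnC addnK easts_below_hook.
have split_rows : perm_eq [seq v <- V | out_north v]
    ([seq v <- V | out_north v && (n <= v)] ++
     [seq v <- V | out_north v && (v < n)]).
  rewrite perm_sym; apply: perm_trans (permEl (perm_filterC (leq n) _)).
  rewrite -!filter_predI; set A := filter _ _; set B := filter _ V.
  rewrite [X in perm_eq _ (X ++ _)](_ : _ = A);
    first rewrite [X in perm_eq _ (_ ++ X)](_ : _ = B) //;
    by apply: eq_filter => v /=; rewrite ?ltnNge andbC.
have zeros : nseq (n - size s) 0 =
    [seq easts_below v | v <- V & out_north v && (v < n)].
  have -> : n - size s = size [seq v <- V | out_north v && (v < n)].
    have := perm_size split_rows; rewrite size_cat => nE.
    rewrite (etrans (size_filter _ _) count_out_north) in nE.
    move: nE; rewrite (perm_size sE) size_map.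
    set A := size _; set B := size _ => nE; by rewrite [X in X - _]nE addKn.
  rewrite -(size_map easts_below); apply/esym/all_pred1P/allP => e /mapP[v].
  rewrite mem_filter => /andP[/andP[_ /ltnW/easts_below_small z] _] ->.
  exact/eqP.
have s_sorted : sorted geq s by apply: sort_sorted => x y; rewrite leq_total.
apply: (@sorted_eq _ geq).
- by move=> y x z h1 h2; apply: leq_trans h2 h1.
- by move=> x y; rewrite andbC; apply: anti_leq.
- have zero_path x m : path geq x (nseq m 0).
    by elim: m x => //= m IH x; rewrite IH.
  case: (s) s_sorted => [|x t] /=; first by case: (n - 0) => //= m.
  by rewrite cat_path zero_path andbT.
- rewrite rev_sorted sorted_map.
  apply: sub_sorted (sorted_filter ltn_trans _ sorted_levels_ltn) => u v /= uv.
  by apply: sub_count => w /andP[-> wu]; apply: ltn_trans wu uv.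
have -> : perm_eq (s ++ nseq (n - size s) 0) =1
          perm_eq (map easts_below [seq v <- V | out_north v]).
  apply/permPl; rewrite zeros; apply: perm_trans (perm_cat sE (perm_refl _)) _.
  by rewrite -map_cat perm_map // perm_sym.
by rewrite perm_sym perm_rev.
Qed.

Lemma size_sweep : size sweep = size P.
Proof. by rewrite size_map (perm_size perm_levels) size_mkseq. Qed.

Lemma sweep_counts : count_mem north sweep = n /\ count_mem east sweep = n.+1.
Proof.
have cN : count_mem north sweep = n.
  rewrite count_map -[RHS]count_out_north; apply: eq_count => v /=.
  by case: (out_north v).
split=> //; have := count_east_north sweep.
by rewrite cN size_sweep dyck_size; lia.
Qed.

Lemma zeta_sweep : zeta n n.+1 P = sweep.
Proof.
case: sweep_counts => cN cE.
by rewrite /zeta zeta_partition_sweep bounding_path_row_widths.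
Qed.

(** * Departures and arrivals in the order of the levels *)

Let V_sorted : sorted ltn V := sorted_levels_ltn.

Lemma size_levels : size V = size P.
Proof. by rewrite (perm_size perm_levels) size_mkseq. Qed.

Lemma level_in (k : nat) : k <= size P -> level k \in V.
Proof.
rewrite leq_eqVlt => /predU1P[->|kP]; last by apply/mem_levels; exists k.
apply/mem_levels; exists 0; first by rewrite dyck_size; lia.
by rewrite level0 level_end.
Qed.

Lemma least_level : nth 0 V 0 = 0.
Proof.
have : 0 \in V by rewrite -level0 level_in.
case: V V_sorted => //= x s xs; rewrite inE => /predU1P[//|s0].
by have := allP (order_path_min ltn_trans xs) 0 s0.
Qed.

Lemma in_east_word : map in_east V = true :: take (size P).-1 sweep.
Proof.
have sP : 0 < size P by rewrite dyck_size; lia.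
have szt : size (take (size P).-1 sweep) = (size P).-1.
  by rewrite size_takel // size_sweep leq_pred.
apply: (@eq_from_nth _ true) => [|i].
  by rewrite size_map size_levels /= szt prednK.
rewrite size_map => iV; rewrite (nth_map 0) //.
case: i iV => [|i] iV /=; first by rewrite least_level.
rewrite in_east_next // nth_take; last by rewrite -size_levels; lia.
by rewrite (nth_map 0) // ltnW.
Qed.

(** Reversing the word of a path rotates it by 180 degrees: the rotated reverse
    path lists the arriving steps in the order of the levels. *)
Lemma rev_reverse_sweep : dyck n n.+1 sweep ->
  rev (reverse_path n sweep) = map (fun v => ~~ in_east v) V.
Proof.
move=> /dyck_last[U [sweepE UN UE]].
rewrite sweepE reverse_path_complement // rev_rcons revK.
rewrite (map_comp negb in_east) in_east_word sweepE /= -cats1 take_size_cat //.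
by rewrite -size_sweep sweepE size_rcons.
Qed.

(** * The sweep of a Dyck path is a Dyck path *)

(** The path returns to level 0, and only east steps go down. *)
Lemma exists_crossing (t k : nat) : 0 < t -> k < size P -> t <= level k ->
  exists m,
    [/\ m < size P, nth north P m = east, t <= level m & level m.+1 < t].
Proof.
move=> t0 kP.
elim: {k}(size P - k.+1) {-2}k (erefl (size P - k.+1)) kP => [|d IH] k dE kP tk.
  have kE : k.+1 = size P by lia.
  exists k; rewrite kE level_end; split=> //.
  case E : (nth north P k) => //; have := level_north kP E.
  by rewrite kE level_end; lia.
have [lt|ge] := ltnP (level k.+1) t; last by apply: (IH k.+1); lia.
exists k; split=> //; case E : (nth north P k) => //.
by have := level_north kP E; lia.
Qed.

Lemma count_east_levels (t : nat) :
  count (fun v => ~~ out_north v && (v < t)) V =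
    count (fun m => ~~ nth north P m && (level m < t)) (iota 0 (size P)) /\
  count (fun v => in_east v && (v < t)) V =
    count (fun m => ~~ nth north P m && (level m.+1 < t)) (iota 0 (size P)).
Proof.
rewrite (permP perm_levels) (permP perm_levels_end) !count_map.
split; apply: eq_in_count => m; rewrite mem_iota => mP /=.
  by rewrite out_north_level.
by rewrite in_east_level.
Qed.

(** Cut the path at the level [t] of place [k].  All east steps that start below
    [t] end below [t], and at least one more ends there because the path comes
    back from [t] to 0.  By [in_east_word] the east arrivals below [t] are,
    apart from the one at 0, as many as the north letters among the first
    [k - 1], so a proper prefix has at most as many east as north letters. *)
Lemma dyck_sweep : dyck n n.+1 sweep.
Proof.
have [cN cE] := sweep_counts.
apply/and3P; split; [exact/eqP|exact/eqP|].
apply/allP => k; rewrite mem_iota add0n ltnS leq0n /= size_sweep => kP.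
have [->|k0] := posnP k; first by rewrite /xcoord take0 muln0.
have [kV|Vk] := ltnP k (size P); last first.
  rewrite /xcoord /ycoord take_oversize ?size_sweep // cN cE; lia.
set t := nth 0 V k; have t0 : 0 < t.
  rewrite -least_level; apply: (sorted_ltn_nth ltn_trans 0 V_sorted) => //;
    by rewrite inE size_levels; lia.
have tk : take k V = [seq v <- V | v < t].
  by rewrite take_nth_sorted ?size_levels.
have xE : xcoord sweep k = count (fun v => ~~ out_north v && (v < t)) V.
  rewrite /xcoord -map_take tk count_map count_filter; apply: eq_count => v /=.
  by case: (out_north v).
have eE : (ycoord sweep k.-1).+1 = count (fun v => in_east v && (v < t)) V.
  have -> : count (fun v => in_east v && (v < t)) V =
            count id (take k (map in_east V)).
    by rewrite -map_take tk count_map count_filter; apply: eq_count => v.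
  rewrite in_east_word -(prednK k0) /= take_takel ?add1n; last by lia.
  by congr S; apply: eq_count; case.
have [_ mono] := leq_coord sweep (leq_pred k).
have lt : xcoord sweep k < (ycoord sweep k.-1).+1.
  rewrite xE eE; have [-> ->] := count_east_levels t.
  have [j jP jE] : exists2 j, j < size P & level j = t.
    by apply/mem_levels/mem_nth; rewrite size_levels.
  have [|m [mP mE tm mt]] := @exists_crossing t j t0 jP; first by rewrite jE.
  apply: (@ltn_count _ _ _ _ m); rewrite ?mem_iota ?add0n ?mE ?mt //.
    move=> i; rewrite mem_iota => iP /andP[iE it].
    rewrite iE; apply: leq_ltn_trans it.
    by rewrite (level_east iP (negbTE iE)) leq_addr.
  by rewrite -leqNgt.
have : xcoord sweep k <= ycoord sweep k by lia.
by move=> h; rewrite leq_mul.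
Qed.

(** * Gamma follows the path *)

Definition rank (k : nat) : nat := index (level k) V.

Lemma rank0 : rank 0 = 0.
Proof.
rewrite /rank level0; have := least_level.
by have := level_in (leq0n _); rewrite level0; case: V => //= x s _ ->.
Qed.

(** Among the steps of one type, the order of the starting levels is that of the
    ending levels, since they differ by a constant. *)
Lemma gamma_rank (k : nat) : k < size P ->
  gamma sweep (reverse_path n sweep) (rank k) = rank k.+1.
Proof.
move=> kP; have kV := level_in (ltnW kP); have kV' := level_in kP.
have outE : nth north sweep (rank k) = nth north P k.
  by rewrite (nth_map 0) ?index_mem // nth_index // out_north_level.
rewrite /gamma outE rev_reverse_sweep ?dyck_sweep //.
set s := nth north P k; set W := map _ _.
have -> : count_mem s (take (rank k) sweep) = count_mem s (take (rank k.+1) W).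
  rewrite -!map_take !take_index_sorted // !count_map !count_filter.
  rewrite (permP perm_levels) (permP perm_levels_end) !count_map.
  apply: eq_in_count => m; rewrite mem_iota => mP /=.
  rewrite out_north_level // in_east_level // negbK.
  case: eqP => //= mE; case E : s mE => mE.
    by rewrite !level_north // ltn_add2r.
  by rewrite (level_east mP mE) (level_east kP E) ltn_add2r.
apply: step_pos_count; first by rewrite size_map index_mem.
by rewrite (nth_map 0) ?index_mem // nth_index // in_east_level // negbK.
Qed.

Lemma sigma_sweep :
  sigma n n.+1 sweep (reverse_path n sweep) = mkseq rank (size P).
Proof.
rewrite /sigma -dyck_size; set f := gamma _ _.
have iterE k : k <= size P -> iter k f 0 = rank k.
  elim: k => [|k IH] kP; first by rewrite rank0.
  by rewrite iterS IH ?(ltnW kP) // /f gamma_rank.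
apply: (@eq_from_nth _ 0) => [|k]; rewrite size_traject ?size_mkseq // => kP.
by rewrite nth_mkseq // nth_traject // iterE // ltnW.
Qed.

Lemma rank_end : rank (size P) = 0.
Proof. by rewrite -[RHS]rank0 /rank level_end level0. Qed.

Lemma sweep_single_cycle :
  gamma_single_cycle n n.+1 sweep (reverse_path n sweep).
Proof.
apply/andP; split.
  have := sigma_sweep; rewrite /sigma -dyck_size; set f := gamma _ _.
  move=> sE; have sP : 0 < size P by rewrite dyck_size; lia.
  have closes : iter (size P) f 0 = 0.
    rewrite -[RHS]rank_end -(prednK sP) iterS -gamma_rank ?prednK // -/f.
    congr f; rewrite -(nth_mkseq 0 rank (_ : _ < size P)) ?prednK //.
    by rewrite -sE nth_traject ?prednK.
  move: closes; rewrite -(prednK sP) /= -iterS iterSr => closes.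
  by rewrite -[X in rcons _ X]closes -trajectSr fpath_traject.
rewrite sigma_sweep -dyck_size -size_levels.
have -> : iota 0 (size V) = [seq index v V | v <- V].
  apply: (@eq_from_nth _ 0) => [|i]; rewrite size_iota ?size_map // => iV.
  by rewrite nth_iota // (nth_map 0) // index_uniq // uniq_levels.
rewrite perm_sym (perm_trans (perm_map _ perm_levels)) //.
by rewrite /levels -map_comp size_levels.
Qed.

(** A cyclic descent of the ranks is a step that goes down, hence an east
    step. *)
Lemma iota_sweep : iota_path n n.+1 sweep (reverse_path n sweep) = P.
Proof.
rewrite /iota_path sigma_sweep -dyck_size.
apply: (@eq_from_nth _ north) => [|i]; rewrite size_mkseq // => iP.
have sP : 0 < size P by lia.
rewrite nth_mkseq // !nth_mkseq ?ltn_mod //.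
have -> : rank (i.+1 %% size P) = rank i.+1.
  have := iP; rewrite leq_eqVlt => /predU1P[->|lt]; last by rewrite modn_small.
  by rewrite modnn rank0 rank_end.
rewrite index_ltn_sorted ?level_in //; last by rewrite ltnW.
case E : (nth north P i).
  by rewrite (level_north iP E) ltnNge leq_addr.
by rewrite (level_east iP E) -[X in X < _]addn0 ltn_add2l n_gt0.
Qed.

End Sweep.

(** * Inverting zeta *)

(** [iota_sweep] makes zeta injective on the finite set of Dyck paths, which it
    maps to itself. *)
Lemma zeta_surjective (n : nat) (Q : lpath) : 0 < n -> dyck n n.+1 Q ->
  exists2 P, dyck n n.+1 P & zeta n n.+1 P = Q.
Proof.
move=> n0 Qd; pose N := n + n.+1.
pose D := [set t : N.-tuple bool | dyck n n.+1 t].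
pose f (t : N.-tuple bool) : N.-tuple bool := insubd t (zeta n n.+1 t).
have fE t : t \in D -> val (f t) = sweep n t.
  rewrite inE => td; rewrite insubdK ?zeta_sweep //.
  by apply/eqP; rewrite size_sweep size_tuple.
have fD : f @: D = D.
  apply/eqP; rewrite eqEcard card_in_imset ?leqnn ?andbT; last first.
    move=> t u tD uD tu; apply: val_inj; move: (tD) (uD); rewrite !inE => td ud.
    rewrite /= -[tval t](iota_sweep n0 td) -[tval u](iota_sweep n0 ud).
    by rewrite -(fE t tD) -(fE u uD) tu.
  apply/subsetP => u /imsetP[t tD ->]; rewrite inE fE //.
  by apply: dyck_sweep => //; move: tD; rewrite inE.
have szQ : size Q == N by rewrite (dyck_size Qd).
have : Tuple szQ \in f @: D by rewrite fD inE.
case/imsetP => t tD /(congr1 val) /= ->; exists t.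
  by move: tD; rewrite inE.
by rewrite fE // zeta_sweep //; move: tD; rewrite inE.
Qed.

Theorem theorem7p2 (n : nat) (Q : lpath) (n_gt0 : 0 < n)
    (Q_dyck : dyck n n.+1 Q) :
  gamma_single_cycle n n.+1 Q (reverse_path n Q) /\
  (forall P : lpath,
     dyck n n.+1 P /\ zeta n n.+1 P = Q <->
     P = iota_path n n.+1 Q (reverse_path n Q)).
Proof.
have [P0 P0_dyck zP0] := zeta_surjective n_gt0 Q_dyck; split.
  by rewrite -zP0 zeta_sweep //; apply: sweep_single_cycle.
move=> P; split=> [[P_dyck <-]|->]; first by rewrite zeta_sweep // iota_sweep.
by rewrite -zP0 zeta_sweep // iota_sweep // zeta_sweep.
Qed.
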